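(* Let $E$ be a Banach space, let $1\le p<q\le\infty$ and let $1\le r\le\infty$. Then the set $\mathscr{A}:=\mathcal K_q(E,\overline{\ell}_r)\setminus\mathcal K_p(E,\overline{\ell}_r)$, regarded as a subset of the Banach space $(\mathcal K_q(E,\overline{\ell}_r),\|\cdot\|_{\mathcal K_q})$, is either empty or $\overline{\ell}_r$-spaceable. If $\mathscr{A}\neq\emptyset$, then there is a subspace $M\subset\mathscr{A}\cup\{0\}$ isomorphic to $\overline{\ell}_r$ and satisfying $$d(M,\overline{\ell}_r)\le\inf_{S\in\mathscr{A}}\frac{\|S\|_{\mathcal K_q}}{\|S\|}.$$ Moreover, if $\mathscr{A}\neq\emptyset$ and $r\ge q$, then $\mathscr{A}$ is isometrically $\overline{\ell}_r$-spaceable.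
   Context: Banach spaces are over $\mathbb K=\mathbb R$ or $\mathbb C$; $B_E$ is the open unit ball of $E$; $\overline{\ell}_r=\ell_r$ if $r<\infty$ and $\overline{\ell}_\infty=c_0$. For $1\le p<\infty$ with conjugate index $p'$, $\ell_p(F)$ is the space of norm $p$-summable sequences in $F$ with norm $(\sum_n\|x_n\|^p)^{1/p}$. A set $K\subset F$ is (relatively) $p$-compact if there is $(x_n)_n\in\ell_p(F)$ with $K\subset p\text{-co}\{(x_n)_n\}:=\{\sum_n\alpha_nx_n:(\alpha_n)_n\in B_{\ell_{p'}}\}$, and $m_p(K;F)$ (the $p$-compact measure) is the infimum of $\|(x_n)_n\|_{\ell_p(F)}$ over all such sequences. A bounded linear $T:E\to F$ is $p$-compact if $T(B_E)$ is $p$-compact; $\mathcal K_p(E,F)$ is the space of these operators, a Banach space with norm $\|T\|_{\mathcal K_p}=m_p(T(B_E);F)$. For $q=\infty$, $\mathcal K_\infty(E,F)$ is the space of compact operators with the operator norm. One has $\mathcal K_p(E,F)\subset\mathcal K_q(E,F)$ for $p<q$. $\|S\|$ denotes the operator norm. A subset $A$ of a Banach space $X$ is $\mathcal S$-spaceable, for a Banach space $\mathcal S$, if $A\cup\{0\}$ contains a linear subspace of $X$ isomorphic to $\mathcal S$; it is isometrically $\mathcal S$-spaceable if there is a linear isometry from $\mathcal S$ into $X$ with range contained in $A\cup\{0\}$. The Banach–Mazur distance is $d(X,Y)=\inf\{\|T\|\,\|T^{-1}\|:T:X\to Y\text{ an isomorphism}\}$. The subspace $M$ carries the norm $\|\cdot\|_{\mathcal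 K_q}$. *)

(* Defs.v *)
From HB Require Import structures.
From mathcomp Require Import all_boot all_order all_algebra.
From mathcomp Require Import finmap complex.
From mathcomp Require Import all_classical all_reals all_analysis.
From mathcomp Require Import ess_sup_inf.

Set Implicit Arguments.
Unset Strict Implicit.
Unset Printing Implicit Defensive.

Import Order.TTheory GRing.Theory Num.Theory numFieldNormedType.Exports.

Local Open Scope classical_set_scope.
Local Open Scope ring_scope.

Variant scalars := RealScalars | ComplexScalars.

Definition scalar_field (R : realType) (k : scalars) : numFieldType :=
  match k with
  | RealScalars => R
  | ComplexScalars => (R[i] : numFieldType)
  end.

Section scalars.
Variables (R : realType) (k : scalars).
Local Notation K := (scalar_field R k).

(* Norms of a [normedModType K] take their values in [K]: they are elements of
   the copy of [R] inside [K], which [to_real] reads back as real numbers. *)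
Definition to_real : K -> R :=
  match k return scalar_field R k -> R with
  | RealScalars => id
  | ComplexScalars => @complex.Re R
  end.

Definition of_real : R -> K :=
  match k return R -> scalar_field R k with
  | RealScalars => id
  | ComplexScalars => fun x : R => (x%:C)%C
  end.

Lemma of_realK : cancel of_real to_real.
Proof. by rewrite /of_real /to_real; case: k. Qed.

Lemma of_realD x y : of_real (x + y) = of_real x + of_real y.
Proof. by rewrite /of_real; case: k => //=; rewrite rmorphD. Qed.

Lemma of_realM x y : of_real (x * y) = of_real x * of_real y.
Proof. by rewrite /of_real; case: k => //=; rewrite rmorphM. Qed.

Lemma of_real0 : of_real 0 = 0.
Proof. by rewrite /of_real; case: k. Qed.

Lemma of_real1 : of_real 1 = 1.
Proof. by rewrite /of_real; case: k. Qed.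

Lemma of_realV x : of_real x^-1 = (of_real x)^-1.
Proof. by rewrite /of_real; case: k => //=; rewrite fmorphV. Qed.

Lemma ler_of_real x y : (of_real x <= of_real y) = (x <= y).
Proof. by rewrite /of_real; case: k => //=; rewrite lecR. Qed.

Lemma ltr_of_real x y : (of_real x < of_real y) = (x < y).
Proof. by rewrite /of_real; case: k => //=; rewrite ltcR. Qed.

Lemma norm_of_real x : `|of_real x| = of_real `|x|.
Proof.
rewrite /of_real; case: k => //=.
by rewrite normc_def /= expr0n /= addr0 sqrtr_sqr.
Qed.

Lemma to_realK (x : K) : 0 <= x -> of_real (to_real x) = x.
Proof.
rewrite /of_real /to_real; case: k x => //= x x0.
by apply: RRe_real; exact: ger0_real.
Qed.

Definition nrm (V : normedModType K) (x : V) : R := to_real `|x|.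

Section nrm.
Variable V : normedModType K.
Implicit Types x y : V.

Lemma nrmE x : `|x| = of_real (nrm x).
Proof. by rewrite to_realK. Qed.

Lemma nrm_ge0 x : 0 <= nrm x.
Proof. by rewrite -ler_of_real -nrmE of_real0. Qed.

Lemma ler_nrmD x y : nrm (x + y) <= nrm x + nrm y.
Proof. by rewrite -ler_of_real of_realD -!nrmE ler_normD. Qed.

Lemma nrmZ (a : K) x : nrm (a *: x) = nrm a * nrm x.
Proof.
rewrite -[LHS]of_realK -nrmE normrZ nrmE.
by rewrite -[X in X * _]to_realK// -of_realM of_realK. Qed.

Lemma nrm_eq0 x : nrm x = 0 -> x = 0.
Proof. by move=> x0; apply/normr0_eq0; rewrite nrmE x0 of_real0. Qed.

Lemma nrm0 : nrm (0 : V) = 0.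
Proof. by rewrite /nrm normr0 -of_real0 of_realK. Qed.

Lemma nrm_sum (u : nat -> V) n :
  nrm (\sum_(0 <= i < n) u i) <= \sum_(0 <= i < n) nrm (u i).
Proof.
elim: n => [|n ih]; first by rewrite !big_geq// nrm0.
by rewrite !big_nat_recr//= (le_trans (ler_nrmD _ _))// lerD2r.
Qed.

End nrm.

Lemma nrm_of_real x : nrm (of_real x : K) = `|x|.
Proof. by rewrite /nrm norm_of_real of_realK. Qed.

End scalars.
Arguments of_real {R k}.
Arguments to_real {R k}.

Record exponent (R : realType) := Exponent {
  exponent_val :> \bar R;
  exponent_ge1 : (1 <= exponent_val)%E }.

Section sequences.
Variables (R : realType) (k : scalars).
Local Notation K := (scalar_field R k).
Implicit Types (p r : \bar R).

(* The norm of l_p(V); [counting] has no nonempty null set, so that for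
   [p = +oo] the essential supremum is the supremum. *)
Definition lnorm (V : normedModType K) p (x : nat -> V) : \bar R :=
  'N[counting]_p[EFin \o (nrm (V:=V) \o x)]%E.


Definition seq_bound p (f : nat -> R) (c : R) : Prop :=
  match p with
  | r%:E => forall n, \sum_(0 <= i < n) f i `^ r <= c `^ r
  | +oo%E => forall n, f n <= c
  | -oo%E => False
  end.

Lemma ae_counting (P : set nat) :
  (\forall n \ae (@counting nat R), P n) -> forall n, P n.
Proof.
move=> [A [mA A0 PA]] n; apply: contrapT => Pn; have : A n by exact: PA.
move: A0; rewrite /= /counting; case: asboolP => // finA /eqP.
rewrite eqe pnatr_eq0 cardfs_eq0 => /eqP A0.
by move: (in_fset_set finA n); rewrite A0 inE => /esym/negP; rewrite inE.
Qed.

Lemma Lnorm_seqP p (f : nat -> R) (c : R) :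
  (1 <= p)%E -> (forall n, 0 <= f n) -> 0 <= c ->
  ('N[counting]_p[EFin \o f] <= c%:E)%E <-> seq_bound p f c.
Proof.
move=> + f0; case: p => [r| |] //; rewrite ?lee_fin => r1 c0.
- have r0 : 0 < r by exact: lt_le_trans r1.
  pose S := (\sum_(i <oo) (f i `^ r)%:E)%E.
  have Sge0 : (0 <= S)%E by apply: nneseries_ge0 => n _ _; rewrite lee_fin powR_ge0.
  have -> : ('N[counting]_r%:E[EFin \o f] = S `^ r^-1)%E.
    rewrite Lnorm_counting//; congr (_ `^ _)%E.
    by apply: eq_eseriesr => i _ /=; rewrite ger0_norm// f0.
  have -> : (S `^ r^-1 <= c%:E)%E <-> (S <= (c `^ r)%:E)%E.
    split=> h.
      have := gt0_ler_poweR (ltW r0) _ _ h.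
      rewrite !in_itv /= !leey poweR_ge0 lee_fin c0 => /(_ isT isT).
      by rewrite -poweRrM mulVf ?gt_eqF// poweRe1.
    have ri : 0 <= r^-1 by rewrite invr_ge0 ltW.
    have := gt0_ler_poweR ri _ _ h.
    rewrite !in_itv /= !leey Sge0 lee_fin powR_ge0 => /(_ isT isT).
    by rewrite -powRrM mulfV ?gt_eqF// powRr1.
  split=> [h n|h].
    rewrite -lee_fin -sumEFin (le_trans _ h)//.
    by apply: nneseries_lim_ge => i _ _; rewrite lee_fin powR_ge0.
  apply: lime_le.
    by apply: is_cvg_nneseries => n _ _; rewrite lee_fin powR_ge0.
  by apply: nearW => n; rewrite sumEFin lee_fin.
- rewrite unlock.
  have -> : (0 < @counting nat R setT)%E.
    by rewrite /counting asboolF//; exact: infinite_nat.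
  split=> [/ess_supP/ae_counting h n|h].
    by have := h n; rewrite /= lee_fin ger0_norm.
  apply/ess_supP/nearW => n /=.
  by rewrite lee_fin ger0_norm.
Qed.

Section lnorm.
Variable V : normedModType K.
Implicit Types x y : nat -> V.

Lemma lnorm_ge0 p x : (0 <= lnorm p x)%E.
Proof. exact: Lnorm_ge0. Qed.

Lemma lnormP p x (c : R) : (1 <= p)%E -> 0 <= c ->
  (lnorm p x <= c%:E)%E <-> seq_bound p (nrm (V:=V) \o x) c.
Proof. by move=> p1 c0; apply: Lnorm_seqP => // n; exact: nrm_ge0. Qed.

Lemma nrm_le_lnorm p x n (c : R) : (1 <= p)%E -> (lnorm p x <= c%:E)%E ->
  nrm (x n) <= c.
Proof.
move=> p1 xc; have c0 : 0 <= c by rewrite -lee_fin (le_trans _ xc)// lnorm_ge0.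
case: p p1 xc => [r| |] // r1 /lnormP; last by move=> /(_ r1 c0); exact.
move=> /(_ r1 c0) /(_ n.+1) h.
have r0 : 0 < r by move: r1; rewrite lee_fin; exact: lt_le_trans.
rewrite leNgt; apply/negP => cx.
have := gt0_ltr_powR r0 c0 (nrm_ge0 _) cx.
rewrite ltNge (le_trans _ h)// big_nat_recr//= lerDr sumr_ge0// => i _.
exact: powR_ge0.
Qed.

Lemma lnorm_lt_oo p x : (lnorm p x < +oo)%E ->
  exists2 c : R, 0 <= c & lnorm p x = c%:E.
Proof.
move=> xoo; exists (fine (lnorm p x)); first by rewrite fine_ge0// lnorm_ge0.
by rewrite fineK// ge0_fin_numE// lnorm_ge0.
Qed.

Lemma lnormZ_le p x (a : K) (c : R) : (1 <= p)%E ->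
  (lnorm p x <= c%:E)%E ->
  (lnorm p (fun n => a *: x n) <= (nrm a * c)%:E)%E.
Proof.
move=> p1 xc; have c0 : 0 <= c by rewrite -lee_fin (le_trans _ xc)// lnorm_ge0.
have ac0 : 0 <= nrm a * c by rewrite mulr_ge0// nrm_ge0.
apply/lnormP => //; move/lnormP : xc => /(_ p1 c0).
case: p p1 => [r| |] //= r1 xc n.
- under eq_bigr do rewrite nrmZ powRM ?nrm_ge0//.
  by rewrite -mulr_sumr powRM ?nrm_ge0// ler_wpM2l// powR_ge0.
- by rewrite nrmZ ler_wpM2l// nrm_ge0.
Qed.

Lemma lnormD_le p x y (a b : R) : (1 <= p)%E ->
  (lnorm p x <= a%:E -> lnorm p y <= b%:E ->
   lnorm p (fun n => x n + y n)%R <= (a + b)%:E)%E.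
Proof.
move=> p1 xa yb.
have a0 : 0 <= a by rewrite -lee_fin (le_trans _ xa)// lnorm_ge0.
have b0 : 0 <= b by rewrite -lee_fin (le_trans _ yb)// lnorm_ge0.
pose f := (nrm (V:=V) \o x) \+ (nrm (V:=V) \o y).
have f0 n : 0 <= f n by rewrite addr_ge0// nrm_ge0.
have : ('N[counting]_p[EFin \o f] <= (a + b)%:E)%E.
  by rewrite EFinD (le_trans (eminkowski _ _ _ _))// leeD.
move/(Lnorm_seqP p1 f0 (addr_ge0 a0 b0)) => h.
apply/lnormP => //; first exact: addr_ge0.
move: h; case: p p1 xa yb => [r| |] //= r1 _ _ h n.
  rewrite (le_trans _ (h n))// ler_sum// => i _.
  rewrite ge0_ler_powR ?nnegrE ?nrm_ge0 ?addr_ge0 ?nrm_ge0 ?ler_nrmD//.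
  by move: r1; rewrite lee_fin; exact: le_trans.
exact: le_trans (ler_nrmD _ _) (h n).
Qed.

Lemma lnorm_le0 p x : (1 <= p)%E -> (lnorm p x <= 0)%E -> x = cst 0.
Proof.
move=> p1 x0; apply/funext => n; apply: nrm_eq0.
by apply/eqP; rewrite eq_le nrm_ge0 (nrm_le_lnorm _ p1 x0).
Qed.

Lemma lnorm0 p : (1 <= p)%E -> lnorm p (cst (0 : V)) = 0%E.
Proof.
move=> p1; apply/eqP; rewrite eq_le lnorm_ge0 andbT.
apply/lnormP => //; case: p p1 => [r| |] //=; last by rewrite nrm0.
rewrite lee_fin => r1 n; have r0 : r != 0 by rewrite gt_eqF// (lt_le_trans _ r1).
by rewrite big1 ?powR_ge0// => i _; rewrite nrm0 powR0.
Qed.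

End lnorm.
End sequences.

Section p_compactness.
Variables (R : realType) (k : scalars).
Local Notation K := (scalar_field R k).
Variable F : normedModType K.
Implicit Types (p : \bar R) (x : nat -> F) (A B : set F).

(* [hoelder_conjugate 1 = +oo]: for [p = 1] the coefficients range over the open
   unit ball of l_oo. *)
Definition pco p x : set F :=
  [set y | exists2 a : nat -> K, (lnorm (hoelder_conjugate p) a < 1)%E &
     series (fun n => a n *: x n) @ \oo --> y].

Definition p_compact p A : Prop :=
  exists2 x, (lnorm p x < +oo)%E & A `<=` pco p x.

(* [+oo] when [A] is not p-compact. *)
Definition p_compact_measure p A : \bar R :=
  ereal_inf [set lnorm p x | x in
    [set x | (lnorm p x < +oo)%E /\ A `<=` pco p x]].

Lemma pcoZ p x (c : K) y : pco p x y -> pco p (fun n => c *: x n) (c *: y).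
Proof.
move=> [a a1 ay]; exists a => //.
have -> : (fun n => a n *: (c *: x n)) = c *: (fun n => a n *: x n).
  by apply/funext => n; rewrite scalrfctE scalerA mulrC -scalerA.
rewrite seriesZ; exact: cvgZr.
Qed.

Lemma hoelder_counting p (f g : nat -> R) (a b : R) : (1 <= p)%E ->
  (forall n, 0 <= f n) -> (forall n, 0 <= g n) -> 0 <= a -> 0 <= b ->
  ('N[counting]_(hoelder_conjugate p)[EFin \o f] <= a%:E)%E ->
  ('N[counting]_p[EFin \o g] <= b%:E)%E ->
  forall n, \sum_(0 <= i < n) f i * g i <= a * b.
Proof.
move=> p1 f0 g0 a0 b0 fa gb n; have ab0 : 0 <= a * b by rewrite mulr_ge0.
have fg0 i : 0 <= (f \* g) i by rewrite mulr_ge0.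
have [poo|] := eqVneq p +oo%E.
  move: fa gb; rewrite poo hoelder_conjugatey.
  move=> /(Lnorm_seqP _ f0 a0) /= /(_ (lexx _)) /(_ n).
  rewrite powRr1//; under eq_bigr do rewrite powRr1//.
  move=> fa /(Lnorm_seqP _ g0 b0) /= /(_ (leey _)) gb.
  rewrite (@le_trans _ _ (\sum_(0 <= i < n) f i * b))//.
    by apply: ler_sum => i _; rewrite ler_wpM2l.
  by rewrite -mulr_suml ler_wpM2r.
case: p p1 fa gb => [r| |]//; rewrite lee_fin => r1 fa gb _.
have r0 : 0 < r by exact: lt_le_trans r1.
move: r1; rewrite le_eqVlt => /predU1P[r1|r1].
  move: fa gb; rewrite -r1 hoelder_conjugate1.
  move=> /(Lnorm_seqP _ f0 a0) /= /(_ (leey _)) fa.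
  move=> /(Lnorm_seqP _ g0 b0) /= /(_ (lexx _)) /(_ n).
  rewrite powRr1//; under eq_bigr do rewrite powRr1//.
  move=> gb.
  rewrite (@le_trans _ _ (\sum_(0 <= i < n) a * g i))//.
    by apply: ler_sum => i _; rewrite ler_wpM2r.
  by rewrite -mulr_sumr ler_wpM2l.
have rE : hoelder_conjugate r%:E = (r / (r - 1))%:E.
  rewrite /hoelder_conjugate/= gt_eqF// inver subr_eq0 gt_eqF//.
have : ('N[counting]_1[EFin \o (f \* g)%R] <= (a * b)%:E)%E.
  rewrite rE in fa.
  rewrite EFinM (le_trans (@hoelder _ _ _ _ _ _ (r / (r - 1)) r _ _ _ _ _))//.
  - by rewrite divr_gt0// subr_gt0.
  - by rewrite invf_div mulrBl divff ?gt_eqF// mul1r subrK.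
  - by rewrite lee_pmul// Lnorm_ge0.
move=> /(Lnorm_seqP _ fg0 ab0) /= /(_ (lexx _)) /(_ n).
rewrite powRr1//; under eq_bigr do rewrite powRr1 ?mulr_ge0//.
by [].
Qed.

Lemma nrm_cvg_le (u : nat -> F) y (c : R) : u @ \oo --> y ->
  (forall n, nrm (u n) <= c) -> nrm y <= c.
Proof.
move=> uy uc; rewrite leNgt; apply/negP => cy.
have e0 : 0 < of_real (nrm y - c) :> K by rewrite -of_real0 ltr_of_real subr_gt0.
have /cvgrPdist_lt /(_ _ e0) [N _ /(_ N (leqnn N))] := uy.
rewrite nrmE ltr_of_real ltrBrDr ltNge => /negP; apply.
by rewrite -{1}(subrK (u N) y) (le_trans (ler_nrmD _ _))// lerD2l.
Qed.

Lemma nrm_pco p x y (c : R) : (1 <= p)%E -> (lnorm p x <= c%:E)%E ->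
  pco p x y -> nrm y <= c.
Proof.
move=> p1 xc [a a1 ay].
have c0 : 0 <= c by rewrite -lee_fin (le_trans _ xc)// lnorm_ge0.
apply: nrm_cvg_le ay _ => n.
rewrite /series/= (le_trans (nrm_sum _ _))//.
under eq_bigr do rewrite nrmZ.
rewrite -[leRHS]mul1r.
have h := @hoelder_counting p (nrm (V:=K) \o a) (nrm (V:=F) \o x) 1 c p1.
by apply: h => // [i|i|]; [exact: nrm_ge0|exact: nrm_ge0|exact: ltW].
Qed.

Definition interleave T (u v : nat -> T) n := if odd n then v n./2 else u n./2.

Lemma sum_interleave (V : nmodType) (u v : nat -> V) n :
  \sum_(0 <= i < n) interleave u v i =
  \sum_(0 <= i < uphalf n) u i + \sum_(0 <= i < n./2) v i.
Proof.
elim: n => [|n ih]; first by rewrite !big_geq// addr0.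
rewrite big_nat_recr//= ih /interleave uphalf_half; case: (odd n).
  by rewrite add1n [X in _ = _ + X]big_nat_recr//= addrA.
by rewrite add0n [X in _ = X + _]big_nat_recr//= addrAC.
Qed.

Lemma cvg_half : half @ \oo --> \oo.
Proof.
move=> P [N _ NP]; exists N.*2 => // n /= Nn; apply: NP => /=.
by rewrite geq_half_double.
Qed.

Lemma cvg_uphalf : uphalf @ \oo --> \oo.
Proof.
move=> P [N _ NP]; exists N.*2 => // n /= Nn; apply: NP => /=.
by rewrite geq_uphalf_double leqW.
Qed.

Lemma cvg_series_interleave (u v : nat -> F) y z :
  series u @ \oo --> y -> series v @ \oo --> z ->
  series (interleave u v) @ \oo --> y + z.
Proof.
move=> uy vz.
have -> : series (interleave u v) = (series u \o uphalf) \+ (series v \o half).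
  by apply/funext => n; rewrite /series/= sum_interleave.
by apply: cvgD; [exact: cvg_comp cvg_uphalf uy|exact: cvg_comp cvg_half vz].
Qed.

Lemma nrm_interleave (V : normedModType K) (u v : nat -> V) n :
  nrm (interleave u v n) =
  interleave (nrm (V:=V) \o u) (nrm (V:=V) \o v) n.
Proof. by rewrite /interleave; case: ifP. Qed.

Lemma pcoD (r : R) x y (a b : R) : 1 <= r -> 0 < a -> 0 < b ->
  (lnorm r%:E x <= a%:E)%E -> (lnorm r%:E y <= b%:E)%E ->
  exists2 z, (lnorm r%:E z <= (a + b)%:E)%E &
    forall u v, pco r%:E x u -> pco r%:E y v -> pco r%:E z (u + v).
Proof.
move=> r1 a0 b0 xa yb; have r0 : 0 < r by exact: lt_le_trans r1.
have ab0 : 0 < a + b by rewrite addr_gt0.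
pose sc c : R := ((a + b) / c) `^ (1 - r^-1).
have sc0 c : 0 < c -> 0 < sc c by move=> c0; rewrite powR_gt0// divr_gt0.
have scr c : 0 < c -> sc c `^ r * c `^ r = (a + b) `^ (r - 1) * c.
  move=> c0; rewrite /sc -powRrM mulrBl mul1r mulVf ?gt_eqF//.
  rewrite -(mulr_powRB1 (ltW c0) r0) mulrCA -powRM ?divr_ge0 ?(ltW c0) ?ltW//.
  by rewrite divfK ?gt_eqF// mulrC.
pose z := interleave (fun n => of_real (sc a) *: x n)
                     (fun n => of_real (sc b) *: y n).
exists z.
  apply/lnormP => //; first exact: ltW.
  move=> n /=; under eq_bigr do rewrite nrm_interleave.
  rewrite (eq_bigr (fun i => interleave
      (fun i => sc a `^ r * nrm (x i) `^ r)
      (fun i => sc b `^ r * nrm (y i) `^ r) i)); last first.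
    move=> i _; rewrite /interleave /=; case: ifP => _;
    by rewrite nrmZ nrm_of_real gtr0_norm ?sc0// powRM ?nrm_ge0// ltW// sc0.
  rewrite sum_interleave -!mulr_sumr.
  rewrite -[leRHS](mulr_powRB1 (ltW ab0) r0) [leRHS]mulrC mulrDr -!scr//.
  have /lnormP := xa => /(_ r1 (ltW a0)) /= ha.
  have /lnormP := yb => /(_ r1 (ltW b0)) /= hb.
  by rewrite lerD// ler_wpM2l ?powR_ge0.
move=> u v [al al1 xu] [be be1 yv].
pose ga := interleave (fun n => (of_real (sc a))^-1 * al n)
                      (fun n => (of_real (sc b))^-1 * be n).
exists ga; last first.
  rewrite [X in series X](_ : _ = interleave (fun n => al n *: x n)
                                             (fun n => be n *: y n)).
    exact: cvg_series_interleave.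
  apply/funext => n; rewrite /z /ga /interleave; case: ifP => _.
    by rewrite scalerA mulrAC mulVf ?mul1r// -of_real0 gt_eqF// ltr_of_real sc0.
  by rewrite scalerA mulrAC mulVf ?mul1r// -of_real0 gt_eqF// ltr_of_real sc0.
have [c c0 alc] := lnorm_lt_oo (lt_trans al1 (ltry _)).
have [d d0 bed] := lnorm_lt_oo (lt_trans be1 (ltry _)).
move: al1 be1; rewrite alc bed !lte_fin => c1 d1.
have m1 : Num.max c d < 1 by rewrite gt_max c1.
have m0 : 0 <= Num.max c d by rewrite le_max c0.
suff : (lnorm (hoelder_conjugate r%:E) ga <= (Num.max c d)%:E)%E.
  by move/le_lt_trans; apply; rewrite lte_fin.
have rc1 : (1 <= hoelder_conjugate r%:E)%E by exact: hoelder_conj_ge1.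
have {alc}/(lnormP _ rc1 c0) alc : (lnorm (hoelder_conjugate r%:E) al <= c%:E)%E by rewrite alc.
have {bed}/(lnormP _ rc1 d0) bed : (lnorm (hoelder_conjugate r%:E) be <= d%:E)%E by rewrite bed.
apply/lnormP => //.
have nE i : nrm (ga i) =
  interleave (fun n => (sc a)^-1 * nrm (al n)) (fun n => (sc b)^-1 * nrm (be n)) i.
  rewrite nrm_interleave /interleave /=; case: ifP => _.
    by rewrite -of_realV (nrmZ (of_real _) (be _ : K)) nrm_of_real gtr0_norm// invr_gt0 sc0.
  by rewrite -of_realV (nrmZ (of_real _) (al _ : K)) nrm_of_real gtr0_norm// invr_gt0 sc0.
move: r1; rewrite le_eqVlt => /predU1P[r1|r1].
  have scE c' : sc c' = 1 by rewrite /sc -r1 invr1 subrr powRr0.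
  move: alc bed; rewrite -r1 hoelder_conjugate1 /= => alc bed n.
  rewrite nE !scE invr1 /interleave; case: ifP => _; rewrite mul1r le_max.
    by rewrite bed orbT.
  by rewrite alc.
have rE : hoelder_conjugate r%:E = (r / (r - 1))%:E.
  by rewrite /hoelder_conjugate/= gt_eqF// inver subr_eq0 gt_eqF//.
set q := r / (r - 1) in rE.
have q0 : 0 < q by rewrite divr_gt0// subr_gt0.
move: alc bed; rewrite rE /= => alc bed n.
have scq c' : 0 < c' -> (sc c')^-1 `^ q = c' / (a + b).
  move=> c'0; rewrite -powR_inv1 ?(ltW (sc0 _ _))// powRAC.
  have -> : sc c' `^ q = (a + b) / c'.
    rewrite /sc -powRrM (_ : (1 - r^-1) * q = 1) ?powRr1 ?divr_ge0 ?ltW//.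
    rewrite /q mulrBl mul1r mulrA mulVf ?gt_eqF// -mulrBl divff//.
    by rewrite subr_eq0 gt_eqF.
  by rewrite powR_inv1 ?invf_div// divr_ge0// ltW.
rewrite (eq_bigr (fun i => interleave
    (fun i => a / (a + b) * nrm (al i) `^ q)
    (fun i => b / (a + b) * nrm (be i) `^ q) i)); last first.
  move=> i _; rewrite /= nE /interleave /=; case: ifP => _;
  by rewrite powRM ?nrm_ge0 ?scq// invr_ge0 ltW// sc0.
rewrite sum_interleave -!mulr_sumr.
rewrite -[leRHS]mul1r -[X in _ <= X * _](@divff _ (a + b)) ?gt_eqF//.
rewrite !mulrDl.
have hm c' : 0 <= c' -> c' <= Num.max c d -> c' `^ q <= Num.max c d `^ q.
  by move=> c'0 c'm; rewrite ge0_ler_powR ?nnegrE// ltW.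
rewrite lerD// ler_wpM2l ?divr_ge0 ?(ltW ab0) ?(ltW a0) ?(ltW b0)//.
  by rewrite (le_trans (alc _))// hm// le_max lexx.
by rewrite (le_trans (bed _))// hm// le_max lexx orbT.
Qed.

End p_compactness.

(* For bounded linear maps the supremum over the open unit ball is the usual
   operator norm; on unbounded maps [sup] returns the default value 0. *)
Definition opnorm (R : realType) (k : scalars)
    (V W : normedModType (scalar_field R k)) (T : V -> W) : R :=
  sup [set nrm (T x) | x in ball 0 1].

Section compact_operators.
Variables (R : realType) (k : scalars).
Local Notation K := (scalar_field R k).
Variables (q : \bar R) (E F : normedModType K).
Implicit Types (S T : E -> F) (c d : R).

Definition compact_operators : set (E -> F) :=
  [set T | [/\ linear T, continuous T &
    if q == +oo%E then precompact (T @` ball 0 1)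
    else p_compact q (T @` ball 0 1)]].

Definition compact_norm T : R :=
  if q == +oo%E then opnorm T
  else fine (p_compact_measure q (T @` ball 0 1)).

Hypothesis q1 : (1 <= q)%E.

Lemma p_compact_measure_le (A : set F) x c :
  (lnorm q x <= c%:E)%E -> A `<=` pco q x -> (p_compact_measure q A <= c%:E)%E.
Proof.
move=> xc Ax; apply: le_trans (xc); apply: ereal_inf_lbound; exists x => //.
by split=> //; rewrite (le_lt_trans xc)// ltry.
Qed.

Lemma p_compact_measure_ge0 (A : set F) : (0 <= p_compact_measure q A)%E.
Proof. by apply: le_ereal_inf_tmp => _ [x _ <-]; exact: lnorm_ge0. Qed.

Lemma p_compact_measure_lt (A : set F) c d :
  (p_compact_measure q A <= c%:E)%E -> c < d ->
  exists2 x, (lnorm q x <= d%:E)%E & A `<=` pco q x.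
Proof.
move=> Ac cd; have : (p_compact_measure q A < d%:E)%E.
  by rewrite (le_lt_trans Ac).
by move=> /ereal_inf_lt[_ [x [_ Ax] <-] /ltW xd]; exists x.
Qed.

(* For [T] in [compact_operators], this says [compact_norm T <= c]. *)
Definition norm_bound T c :=
  if q == +oo%E then forall x, ball 0 1 x -> nrm (T x) <= c
  else (p_compact_measure q (T @` ball (0 : E)%R 1%R) <= c%:E)%E.

Lemma linear_ball_bounded T : linear T -> continuous T ->
  exists M : R, forall x, ball 0 1 x -> nrm (T x) <= M.
Proof.
move=> lT cT.
have T0 : T 0 = 0 by have := lT (-1) 0 0; rewrite !scaler0 addr0 scaleN1r addNr.
have /cvgrPdist_lt /(_ 1 ltr01) /nbhs_ballP[e /= e0 eT] := cT 0.
have TZ a x : T (a *: x) = a *: T x by rewrite -[a *: x]addr0 lT T0 addr0.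
exists (nrm (e^-1 : K)) => x; rewrite -ball_normE /= sub0r normrN => x1.
have : ball 0 e (e *: x).
  by rewrite -ball_normE /= sub0r normrN normrZ gtr0_norm// gtr_pMr.
move=> /eT; rewrite T0 sub0r normrN TZ normrZ => h.
rewrite -(@ler_of_real _ k) -!nrmE normfV -[leRHS]mul1r ler_pdivlMr ?normr_gt0 ?gt_eqF//.
by rewrite mulrC ltW.
Qed.

Lemma norm_boundP T c : compact_operators T -> 0 <= c ->
  norm_bound T c <-> compact_norm T <= c.
Proof.
move=> [lT cT]; rewrite /norm_bound /compact_norm; case: ifPn => _.
  move=> _ _; have [M TM] := linear_ball_bounded lT cT; split=> [Tc|Tc x x1].
    apply: ge_sup; first by exists (nrm (T 0)), 0 => //; exact: ballxx.
    by move=> _ [x x1 <-]; exact: Tc.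
  apply: le_trans Tc; apply: ub_le_sup; last by exists x.
  by exists M => _ [y y1 <-]; exact: TM.
move=> [x xoo Tx] c0; rewrite -lee_fin fineK//.
rewrite ge0_fin_numE ?p_compact_measure_ge0//.
by apply: le_lt_trans (xoo); apply: ereal_inf_lbound; exists x => //; split.
Qed.

Lemma compact_norm_ge0 T : 0 <= compact_norm T.
Proof.
rewrite /compact_norm; case: ifPn => _.
  rewrite /opnorm; set A := [set _ | _ in _].
  have [hA|/sup_out ->//] := pselect (has_sup A).
  rewrite (@le_trans _ _ (nrm (T 0))) ?nrm_ge0//; apply: ub_le_sup.
    by case: hA.
  by exists 0 => //; exact: ballxx.
by rewrite fine_ge0// p_compact_measure_ge0.
Qed.

Lemma compact_norm_bound T : compact_operators T -> norm_bound T (compact_norm T).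
Proof. by move=> Tc; apply/norm_boundP => //; exact: compact_norm_ge0. Qed.

Lemma norm_boundD S T c d : 0 <= c -> 0 <= d ->
  norm_bound S c -> norm_bound T d -> norm_bound (S + T) (c + d).
Proof.
move=> c0 d0; move: p_compact_measure_lt p_compact_measure_le; rewrite /norm_bound.
case: q q1 => [r| |]// r1 mlt mle /=; last first.
  move=> Sc Td x x1; rewrite (le_trans (ler_nrmD _ _))// lerD//.
    exact: Sc.
  exact: Td.
move=> Sc Td; apply/lee_addgt0Pr => e e0.
have e20 : 0 < e / 2 by rewrite divr_gt0.
have [x xc Sx] := mlt _ _ _ Sc (ltr_pwDr e20 (lexx c)).
have [y yd Ty] := mlt _ _ _ Td (ltr_pwDr e20 (lexx d)).
have [z zcd xyz] := pcoD r1 (ltr_wpDl c0 e20) (ltr_wpDl d0 e20) xc yd.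
rewrite -EFinD.
have -> : (c + d + e)%R = (c + e / 2 + (d + e / 2))%R.
  by rewrite addrACA -splitr.
apply: mle zcd _ => _ [u u1 <-].
by apply: xyz; [apply: Sx|apply: Ty]; exists u.
Qed.

Lemma norm_boundZ T a c : 0 <= c -> norm_bound T c ->
  norm_bound (a *: T) (nrm a * c).
Proof.
move=> c0; rewrite /norm_bound; case: ifPn => qoo Tc.
  by move=> x x1; rewrite nrmZ ler_wpM2l ?nrm_ge0//; exact: Tc.
apply/lee_addgt0Pr => e e0.
have na0 : 0 < nrm a + 1 by rewrite ltr_wpDl// nrm_ge0.
have e'0 : 0 < e / (nrm a + 1) by rewrite divr_gt0.
have [x xc Tx] := p_compact_measure_lt Tc (ltr_pwDr e'0 (lexx c)).
have := lnormZ_le a q1 xc; rewrite mulrDr => axc.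
rewrite -EFinD.
apply: (@le_trans _ _ (nrm a * c + nrm a * (e / (nrm a + 1)))%:E).
  apply: p_compact_measure_le axc _ => _ [u u1 <-].
  by apply: pcoZ; apply: Tx; exists u.
rewrite lee_fin lerD2l mulrCA ler_piMr ?(ltW e0)//.
by rewrite ler_pdivrMr// mul1r lerDl.
Qed.

Lemma norm_bound_nrm T c x : norm_bound T c -> ball 0 1 x -> nrm (T x) <= c.
Proof.
rewrite /norm_bound; case: ifPn => _ Tc x1; first exact: Tc.
apply/ler_addgt0Pr => e e0.
have [y yc Ty] := p_compact_measure_lt Tc (ltr_pwDr e0 (lexx c)).
by apply: (nrm_pco q1 yc); apply: Ty; exists x.
Qed.

Lemma norm_bound0_eq0 T : linear T -> norm_bound T 0 -> T = 0.
Proof.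
move=> lT T0; apply/funext => x /=.
have [->|x0] := eqVneq x 0.
  by have := lT (-1) 0 0; rewrite !scaler0 addr0 scaleN1r addNr.
have T00 : T 0 = 0.
  by have := lT (-1) 0 0; rewrite !scaler0 addr0 scaleN1r addNr.
have TZ a y : T (a *: y) = a *: T y by rewrite -[a *: y]addr0 lT T00 addr0.
have nx : 0 < `|x| + 1 by rewrite ltr_wpDl.
have : ball 0 1 ((`|x| + 1)^-1 *: x).
  rewrite -ball_normE /= sub0r normrN normrZ normfV ger0_norm ?ltW//.
  by rewrite mulrC ltr_pdivrMr// mul1r ltrDl.
move=> /(norm_bound_nrm T0); rewrite TZ => h.
have /nrm_eq0/eqP : nrm ((`|x| + 1)^-1 *: T x) = 0.
  by apply/eqP; rewrite eq_le h nrm_ge0.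
by rewrite scaler_eq0 invr_eq0 gt_eqF//= => /eqP.
Qed.

Lemma precompactD (A B : set F) : precompact A -> precompact B ->
  precompact [set x | exists2 a, A a & exists2 b, B b & x = a + b].
Proof.
rewrite !precompactE => cA cB; rewrite -precompactE.
have cAB := compact_setX cA cB.
pose s (z : F * F) := z.1 + z.2.
have cs : compact (s @` (closure A `*` closure B)).
  apply: continuous_compact => //; apply: continuous_subspaceT.
  exact: add_continuous.
apply: (precompact_subset _ (compact_precompact (@norm_hausdorff _ _) cs)).
move=> _ [a Aa [b Bb ->]]; exists (a, b) => //.
by split; exact: subset_closure.
Qed.

Lemma precompactZ (A : set F) (a : K) : precompact A ->
  precompact [set a *: x | x in A].
Proof.
rewrite precompactE => cA.
have cs : compact ((fun x => a *: x) @` closure A).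
  apply: continuous_compact => //; apply: continuous_subspaceT.
  exact: scaler_continuous.
apply: (precompact_subset _ (compact_precompact (@norm_hausdorff _ _) cs)).
by move=> _ [x Ax <-]; exists x => //; exact: subset_closure.
Qed.

Lemma compact_operators0 : compact_operators 0.
Proof.
split.
- by move=> a u v /=; rewrite scaler0 addr0.
- by move=> x; exact: cvg_cst.
have i0 : (0 : E -> F) @` ball 0 1 `<=` [set 0] by move=> _ [x _ <-].
case: ifPn => _.
  apply: (precompact_subset i0).
  by apply: (compact_precompact (@norm_hausdorff _ _)); exact: compact_set1.
exists (cst 0); first by rewrite lnorm0// ltry.
move=> y /i0 ->; exists (cst 0).
  by rewrite lnorm0// ?lte01// hoelder_conj_ge1.
rewrite (_ : series _ = cst 0); first exact: cvg_cst.
by apply/funext => n; rewrite /series/= big1// => i _; rewrite scaler0.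
Qed.

Lemma compact_operatorsP a S T : compact_operators S -> compact_operators T ->
  compact_operators (a *: S + T).
Proof.
move=> cS cT; have := cS; have := cT; move=> [lT ctT qT] [lS ctS qS]; split.
- move=> b u v; rewrite /= !(addrfctE, scalrfctE) lS lT.
  rewrite !scalerDr !scalerA (mulrC a b).
  by rewrite addrACA.
- by move=> x; apply: cvgD; [apply: cvgZr; exact: ctS|exact: ctT].
have bS := norm_boundZ a (compact_norm_ge0 S) (compact_norm_bound cS).
have aS0 : 0 <= nrm a * compact_norm S by rewrite mulr_ge0 ?nrm_ge0 ?compact_norm_ge0.
have := norm_boundD aS0 (compact_norm_ge0 T) bS (compact_norm_bound cT).
move: qS qT; rewrite /norm_bound; case: ifPn => _ qS qT.
  move=> _; apply: precompact_subset (precompactD (precompactZ a qS) qT).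
  move=> _ [x x1 <-]; exists (a *: S x); first by exists (S x) => //; exists x.
  by exists (T x) => //; exists x.
move=> /p_compact_measure_lt /(_ (ltr_pwDr ltr01 (lexx _))) [x xc ST].
by exists x => //; rewrite (le_lt_trans xc)// ltry.
Qed.

Lemma compact_normZ a T : compact_operators T ->
  compact_norm (a *: T) = nrm a * compact_norm T.
Proof.
have le b S : compact_operators S -> compact_norm (b *: S) <= nrm b * compact_norm S.
  move=> cS; apply/norm_boundP.
  - by rewrite -[_ *: _]addr0; exact: compact_operatorsP compact_operators0.
  - by rewrite mulr_ge0 ?nrm_ge0 ?compact_norm_ge0.
  by apply: norm_boundZ; [exact: compact_norm_ge0|exact: compact_norm_bound].
move=> cT; apply/eqP; rewrite eq_le le//=.
have [->|a0] := eqVneq a 0; first by rewrite nrm0 mul0r compact_norm_ge0.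
have na0 : 0 < nrm a.
  rewrite lt_neqAle nrm_ge0 andbT eq_sym; apply: contra a0 => /eqP.
  by move/nrm_eq0 ->.
have caT : compact_operators (a *: T).
  by rewrite -[_ *: _]addr0; exact: compact_operatorsP compact_operators0.
rewrite mulrC -ler_pdivlMr// mulrC.
have := le a^-1 _ caT; rewrite scalerA mulVf// scale1r => /le_trans; apply.
rewrite ler_wpM2r ?compact_norm_ge0//.
rewrite -(@ler_of_real _ k) of_realV -!nrmE normfV; exact: lexx.
Qed.

Lemma compact_normD S T : compact_operators S -> compact_operators T ->
  compact_norm (S + T) <= compact_norm S + compact_norm T.
Proof.
move=> cS cT; apply/norm_boundP.
- by rewrite -[S]scale1r; exact: compact_operatorsP.
- by rewrite addr_ge0 ?compact_norm_ge0.
by apply: norm_boundD; rewrite ?compact_norm_ge0//; exact: compact_norm_bound.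
Qed.

Lemma compact_norm_eq0 T : compact_operators T -> compact_norm T = 0 -> T = 0.
Proof.
move=> cT T0; apply: norm_bound0_eq0; first by case: cT.
by rewrite -T0; exact: compact_norm_bound.
Qed.

End compact_operators.
Arguments compact_operators {R k} q E F _.

Section ellbar.
Variables (R : realType) (k : scalars) (r : exponent R).
Local Notation K := (scalar_field R k).

(* c_0 for [r = +oo], and l_r otherwise; in both cases normed by [lnorm r]. *)
Definition ellbar_mem : {pred nat -> K} := mem [set a : nat -> K |
  if exponent_val r == +oo%E then a @ \oo --> (0 : K) else (lnorm r a < +oo)%E].

Lemma ellbar_lnorm (a : nat -> K) : a \in ellbar_mem -> (lnorm r a < +oo)%E.
Proof.
rewrite inE /=; case: ifPn => // /eqP roo a0.
have [M [_ Ma]] : bounded_fun a by apply: cvg_seq_bounded; apply/cvg_ex; exists 0.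
have {}Ma n : `|a n| <= M + 1.
  by apply: (Ma (M + 1)) => //; rewrite ltrDl.
have M0 : 0 <= M + 1 by rewrite (le_trans _ (Ma 0%N)).
apply: (@le_lt_trans _ _ (to_real (M + 1))%:E); last exact: ltry.
apply/lnormP; first exact: exponent_ge1.
  by rewrite -(@ler_of_real _ k) of_real0 to_realK.
rewrite roo => n /=.
by rewrite -(@ler_of_real _ k) to_realK// -nrmE.
Qed.

Lemma ellbar_submod_closed : submod_closed ellbar_mem.
Proof.
split.
  rewrite inE /=; case: ifPn => _; first exact: cvg_cst.
  by rewrite lnorm0 ?ltry//; exact: exponent_ge1.
move=> c a b aP bP.
have [x x0 xa] := lnorm_lt_oo (ellbar_lnorm aP).
have [y y0 yb] := lnorm_lt_oo (ellbar_lnorm bP).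
move: aP bP; rewrite !inE /=; case: ifPn => _ aP bP.
  rewrite -[0](addr0 (0 : K)) -{1}(scaler0 _ c : c *: (0 : K) = 0).
  by apply: cvgD => //; exact: cvgZr.
apply: (@le_lt_trans _ _ (nrm c * x + y)%:E); last exact: ltry.
apply: lnormD_le; first exact: exponent_ge1.
  by apply: lnormZ_le; [exact: exponent_ge1|rewrite xa].
by rewrite yb.
Qed.

HB.instance Definition _ :=
  GRing.isSubmodClosed.Build K (nat -> K) ellbar_mem ellbar_submod_closed.

Definition ellbar : Type := {a : nat -> K | a \in ellbar_mem}.

HB.instance Definition _ := SubChoice.on ellbar.
HB.instance Definition _ := [SubChoice_isSubLmodule of ellbar by <:].

Definition ellbar_norm (a : ellbar) : K := of_real (fine (lnorm r (val a))).

Let ellbar_normE (a : ellbar) : lnorm r (val a) = (fine (lnorm r (val a)))%:E.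
Proof. by have [x _ ->] := lnorm_lt_oo (ellbar_lnorm (valP a)). Qed.

Lemma ler_ellbar_normD (a b : ellbar) :
  ellbar_norm (a + b) <= ellbar_norm a + ellbar_norm b.
Proof.
rewrite /ellbar_norm -of_realD ler_of_real -lee_fin -ellbar_normE.
by apply: lnormD_le; rewrite ?exponent_ge1// -ellbar_normE.
Qed.

Lemma ellbar_normZ (c : K) (a : ellbar) :
  ellbar_norm (c *: a) = `|c| * ellbar_norm a.
Proof.
have le d b : ellbar_norm (d *: b) <= `|d| * ellbar_norm b.
  rewrite /ellbar_norm nrmE -of_realM ler_of_real -lee_fin -ellbar_normE.
  by apply: lnormZ_le; rewrite ?exponent_ge1// -ellbar_normE.
apply/eqP; rewrite eq_le le /=.
have [->|c0] := eqVneq c 0.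
  by rewrite normr0 mul0r -of_real0 ler_of_real fine_ge0// lnorm_ge0.
rewrite mulrC -ler_pdivlMr ?normr_gt0// mulrC -normfV.
by have := le c^-1 (c *: a); rewrite scalerA mulVf// scale1r.
Qed.

Lemma ellbar_norm_eq0 (a : ellbar) : ellbar_norm a = 0 -> a = 0.
Proof.
rewrite -of_real0 => /(can_inj (@of_realK _ _)) a0.
apply: val_inj; apply: (@lnorm_le0 _ _ _ r); first exact: exponent_ge1.
by rewrite ellbar_normE a0.
Qed.

HB.instance Definition _ := Lmodule_isNormed.Build K ellbar
  ler_ellbar_normD ellbar_normZ ellbar_norm_eq0.

End ellbar.
Arguments ellbar {R} k r.

Section compact_operator_space.
Variables (R : realType) (k : scalars) (q : exponent R).
Local Notation K := (scalar_field R k).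
Variables E F : normedModType K.

Definition compact_op_mem : {pred E -> F} := mem (compact_operators q E F).

Lemma compact_op_submod_closed : submod_closed compact_op_mem.
Proof.
split; first by rewrite inE; apply: compact_operators0; exact: exponent_ge1.
move=> a S T; rewrite !inE; apply: compact_operatorsP; exact: exponent_ge1.
Qed.

HB.instance Definition _ :=
  GRing.isSubmodClosed.Build K (E -> F) compact_op_mem compact_op_submod_closed.

(* K_q(E, F); as an element of this [normedModType], [T] has norm
   [compact_norm q T]. *)
Definition compact_op : Type := {T : E -> F | T \in compact_op_mem}.

HB.instance Definition _ := SubChoice.on compact_op.
HB.instance Definition _ := [SubChoice_isSubLmodule of compact_op by <:].

Definition compact_op_norm (T : compact_op) : K :=
  of_real (compact_norm q (val T)).

Let compact_opP (T : compact_op) : compact_operators q E F (val T).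
Proof. by have := valP T; rewrite inE. Qed.

Lemma ler_compact_op_normD (S T : compact_op) :
  compact_op_norm (S + T) <= compact_op_norm S + compact_op_norm T.
Proof.
rewrite /compact_op_norm -of_realD ler_of_real.
by apply: compact_normD => //; exact: exponent_ge1.
Qed.

Lemma compact_op_normZ (c : K) (T : compact_op) :
  compact_op_norm (c *: T) = `|c| * compact_op_norm T.
Proof.
rewrite nrmE -of_realM /compact_op_norm -compact_normZ//; exact: exponent_ge1.
Qed.

Lemma compact_op_norm_eq0 (T : compact_op) : compact_op_norm T = 0 -> T = 0.
Proof.
rewrite -of_real0 => /(can_inj (@of_realK _ _)) T0.
by apply: val_inj; apply: (compact_norm_eq0 (exponent_ge1 q)).
Qed.

HB.instance Definition _ := Lmodule_isNormed.Build K compact_op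
  ler_compact_op_normD compact_op_normZ compact_op_norm_eq0.

End compact_operator_space.
Arguments compact_op {R k} q E F.

Record linear_subspace (K : numFieldType) (X : normedModType K) := Subspace {
  subspace_mem : {pred X};
  subspace_closed : submod_closed subspace_mem }.

Section linear_subspace.
Variables (K : numFieldType) (X : normedModType K) (M : linear_subspace X).

HB.instance Definition _ :=
  GRing.isSubmodClosed.Build K X (subspace_mem M) (subspace_closed M).

Definition subspace_type : Type := {x : X | x \in subspace_mem M}.

HB.instance Definition _ := SubChoice.on subspace_type.
HB.instance Definition _ := [SubChoice_isSubLmodule of subspace_type by <:].

Definition subspace_norm (x : subspace_type) : K := `|val x|.

Lemma ler_subspace_normD (x y : subspace_type) :
  subspace_norm (x + y) <= subspace_norm x + subspace_norm y.
Proof. exact: ler_normD. Qed.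

Lemma subspace_normZ (c : K) (x : subspace_type) :
  subspace_norm (c *: x) = `|c| * subspace_norm x.
Proof. exact: normrZ. Qed.

Lemma subspace_norm_eq0 (x : subspace_type) : subspace_norm x = 0 -> x = 0.
Proof. by move=> x0; apply: val_inj; exact: normr0_eq0. Qed.

HB.instance Definition _ := Lmodule_isNormed.Build K subspace_type
  ler_subspace_normD subspace_normZ subspace_norm_eq0.

End linear_subspace.
Coercion subspace_type : linear_subspace >-> Sortclass.

Section spaceability.
Variables (R : realType) (k : scalars).
Local Notation K := (scalar_field R k).
Implicit Types X Y S : normedModType K.

Definition isomorphism_pair X Y (T : X -> Y) (U : Y -> X) :=
  [/\ linear T, continuous T, continuous U, cancel T U & cancel U T].

Definition isomorphic X Y := exists T U, @isomorphism_pair X Y T U.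

(* [+oo] when [X] and [Y] are not isomorphic. *)
Definition banach_mazur X Y : \bar R :=
  ereal_inf [set d | exists T U, @isomorphism_pair X Y T U /\
    d = (opnorm T * opnorm U)%:E].

Definition spaceable S X (A : set X) :=
  exists M : linear_subspace X,
    [set` subspace_mem M] `<=` A `|` [set 0] /\ isomorphic M S.

Definition isometrically_spaceable S X (A : set X) :=
  exists J : S -> X, [/\ linear J, (forall x, `|J x| = `|x|) &
    range J `<=` A `|` [set 0]].

End spaceability.

(* Main.v *)
(* Let S be in A, and for a in F = ellbar k r let a (x) y in l_r(N x N) = F
   (c_0(N x N) when r = oo) be the elementary tensor, so that y |-> a (x) y is
   |a| times an isometry. The map a |-> (a (x) _) o S is linear from F to
   K_q(E, F), and it is isometric up to the factor |S|_{K_q}: the upper bound is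
   the left ideal property of K_q, and for the lower bound one applies to
   (a (x) _) o S the contractions phi (x) id of F, with phi in the unit ball of
   l_r', which turn it into phi(a) S. A coordinate functional phi shows that
   (a (x) _) o S is not p-compact when a <> 0. Hence A is isometrically
   F-spaceable for every r, which gives a subspace at Banach-Mazur distance 1
   from F. *)
Require Import Defs.
From HB Require Import structures.
From mathcomp Require Import all_boot all_order all_algebra.
From mathcomp Require Import all_classical all_reals all_analysis.
From Stdlib Require Cantor.

Set Implicit Arguments.
Unset Strict Implicit.
Unset Printing Implicit Defensive.

Import Order.TTheory GRing.Theory Num.Theory numFieldNormedType.Exports.

Local Open Scope classical_set_scope.
Local Open Scope ring_scope.

(** * Cantor pairing and partial sums of double series *)

Local Notation pair_nat := Cantor.to_nat.
Local Notation unpair := Cantor.of_nat.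
Local Arguments Cantor.to_nat : simpl never.
Local Arguments Cantor.of_nat : simpl never.

Lemma pair_nat_inj : injective pair_nat.
Proof. exact: can_inj Cantor.cancel_of_to. Qed.

Lemma unpair_inj : injective unpair.
Proof. exact: can_inj Cantor.cancel_to_of. Qed.

Lemma leq_unpair i : ((unpair i).1 <= i)%N /\ ((unpair i).2 <= i)%N.
Proof.
have /ssrnat.leP := Cantor.to_nat_non_decreasing (unpair i).1 (unpair i).2.
rewrite -surjective_pairing Cantor.cancel_to_of => h.
by split; apply: leq_trans h; rewrite ?leq_addl ?leq_addr.
Qed.

Lemma leq_pair_nat j m : (m <= pair_nat (j, m))%N.
Proof. by have [_] := leq_unpair (pair_nat (j, m)); rewrite Cantor.cancel_of_to. Qed.

(** This places a finite rectangle of pairs inside an initial segment of codes. It serves both to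
    compare partial sums and to see that a large code has a large coordinate. *)
Lemma pair_nat_bounded n m :
  exists N, forall i j, (i < n)%N -> (j < m)%N -> (pair_nat (i, j) < N)%N.
Proof.
exists (\sum_(i < n) \sum_(j < m) (pair_nat (i : nat, j : nat)).+1)%N.
move=> i j ilt jlt; rewrite (bigD1 (Ordinal ilt))//= (bigD1 (Ordinal jlt))//=.
by rewrite -addnA leq_addr.
Qed.

Lemma ler_sum_uniq_sub {R : numDomainType} {I : eqType} (s t : seq I)
    (f : I -> R) :
  uniq s -> uniq t -> {subset s <= t} -> (forall i, 0 <= f i) ->
  \sum_(i <- s) f i <= \sum_(i <- t) f i.
Proof.
move=> us ut st f0; rewrite [leRHS](bigID (mem s))/= -[X in _ <= X + _]big_filter.
have st_s : perm_eq [seq i <- t | i \in s] s.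
  apply: uniq_perm => // [|i]; first exact: filter_uniq.
  by rewrite mem_filter; apply: andb_idr; exact: st.
by rewrite (perm_big _ st_s) lerDl sumr_ge0.
Qed.

Lemma uniq_allpairs_pair (I J : eqType) (s : seq I) (t : seq J) :
  uniq s -> uniq t -> uniq [seq (i, j) | i <- s, j <- t].
Proof. by move=> us ut; apply: allpairs_uniq => // -[? ?] [? ?]. Qed.

(** Both coordinates are at most their code, so the codes below [n] decode to distinct points of the
    square of side [n]. *)
Lemma ler_sum_unpair {R : numDomainType} (f : nat * nat -> R) n :
  (forall z, 0 <= f z) ->
  \sum_(0 <= i < n) f (unpair i) <=
  \sum_(0 <= i < n) \sum_(0 <= j < n) f (i, j).
Proof.
move=> f0; rewrite -(big_map unpair xpredT f) -big_allpairs.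
apply: ler_sum_uniq_sub => //.
- by rewrite map_inj_uniq ?iota_uniq//; exact: unpair_inj.
- by rewrite uniq_allpairs_pair ?iota_uniq.
- move=> _ /mapP[i + ->]; rewrite mem_index_iota leq0n /= => ilt.
  have [i1 i2] := leq_unpair i; apply/allpairsP; exists (unpair i).
  by rewrite !mem_index_iota /= !(leq_ltn_trans _ ilt)// -surjective_pairing.
Qed.

(** The codes of a rectangle are distinct and bounded, so they form part of an initial segment. *)
Lemma ler_sum_pair_nat {R : numDomainType} n m :
  exists N, forall f : nat -> R, (forall i, 0 <= f i) ->
    \sum_(0 <= i < n) \sum_(0 <= j < m) f (pair_nat (i, j)) <=
    \sum_(0 <= i < N) f i.
Proof.
have [N ltN] := pair_nat_bounded n m; exists N => f f0.
rewrite -(big_allpairs (F := f \o pair_nat)) -(big_map pair_nat xpredT f).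
apply: ler_sum_uniq_sub => //; rewrite ?iota_uniq//.
- rewrite map_inj_uniq ?uniq_allpairs_pair ?iota_uniq//; exact: pair_nat_inj.
- move=> _ /mapP[_ /allpairsP[[i j] /= [+ + ->]] ->].
  by rewrite !mem_index_iota /=; exact: ltN.
Qed.

(** * Elementary tensors and their contractions, for scalar sequences *)

Section sequences.
Variables (R : realType) (k : scalars).
Local Notation K := (scalar_field R k).
Implicit Types (a y phi : nat -> K) (r : \bar R).

Lemma to_real_gt0 (e : K) : 0 < e -> 0 < to_real e.
Proof. by move=> e0; rewrite -(@ltr_of_real _ k) of_real0 to_realK// ltW. Qed.

Lemma nrmM (x y : K) : nrm (x * y) = nrm x * nrm y.
Proof. exact: (nrmZ x (y : K^o)). Qed.

Lemma cvg0_nrmP (V : normedModType K) (u : nat -> V) :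
  u @ \oo --> (0 : V) <->
  forall e : R, 0 < e -> exists N, forall n, (N <= n)%N -> nrm (u n) < e.
Proof.
split=> [/cvgr0Pnorm_lt u0 e e0|u0].
  have /u0[N _ uN] : 0 < of_real e :> K by rewrite -of_real0 ltr_of_real.
  by exists N => n Nn; rewrite -(@ltr_of_real _ k) -nrmE; exact: uN.
apply/cvgr0Pnorm_lt => e e0; have [N uN] := u0 _ (to_real_gt0 e0).
by exists N => // n /uN; rewrite nrmE -(@ltr_of_real _ k) to_realK// ltW.
Qed.

(** The double sequence is flattened along the Cantor pairing, which keeps the tensor in the same
    sequence space as its factors. *)
Definition tensor_seq a y : nat -> K :=
  fun i => a (unpair i).1 * y (unpair i).2.

(* [phi (x) id], with [phi] truncated to its first [n] coordinates so that no
   convergence question arises. *)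
Definition contract_seq phi n y : nat -> K :=
  fun m => \sum_(0 <= j < n) phi j * y (pair_nat (j, m)).

Lemma contract_tensor_seq phi n a y :
  contract_seq phi n (tensor_seq a y) = (\sum_(0 <= j < n) phi j * a j) *: y.
Proof.
apply/funext => m; rewrite scalrfctE /contract_seq /GRing.scale/= mulr_suml.
by apply: eq_bigr => j _; rewrite /tensor_seq Cantor.cancel_of_to mulrA.
Qed.

(** For finite [r], a partial sum of the tensor is dominated by the sum over a square, which factors
    into partial sums of [a] and [y]. *)
Lemma lnorm_tensor_seq r a y (al be : R) : (1 <= r)%E ->
  (lnorm r a <= al%:E -> lnorm r y <= be%:E ->
   lnorm r (tensor_seq a y) <= (al * be)%:E)%E.
Proof.
move=> r1 ala bey.
have al0 : 0 <= al by rewrite -lee_fin (le_trans _ ala)// lnorm_ge0.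
have be0 : 0 <= be by rewrite -lee_fin (le_trans _ bey)// lnorm_ge0.
apply/lnormP => //; first exact: mulr_ge0.
move: ala bey => /(lnormP _ r1 al0) + /(lnormP _ r1 be0).
case: r r1 => [r| |]//= r1 ha hy n; last first.
  by rewrite nrmM ler_pM ?nrm_ge0.
pose f z := nrm (a z.1) `^ r * nrm (y z.2) `^ r.
under eq_bigr do rewrite nrmM powRM ?nrm_ge0//.
apply: (le_trans (@ler_sum_unpair _ f n _)).
  by move=> z; rewrite mulr_ge0 ?powR_ge0.
rewrite /f /=; under eq_bigr do rewrite -mulr_sumr.
by rewrite -mulr_suml powRM// ler_pM// sumr_ge0// => i _; exact: powR_ge0.
Qed.

(** Hölder's inequality bounds each entry by [b] times the norm of a column of [y]. For finite [r],
    the r-th powers of the column norms add up to a sum over a rectangle, hence to at most a partial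
    sum for [y]. *)
Lemma lnorm_contract_seq r phi n y (b c : R) : (1 <= r)%E -> 0 <= b ->
  (lnorm (hoelder_conjugate r) phi <= b%:E -> lnorm r y <= c%:E ->
   lnorm r (contract_seq phi n y) <= (b * c)%:E)%E.
Proof.
move=> r1 b0 phib yc.
have c0 : 0 <= c by rewrite -lee_fin (le_trans _ yc)// lnorm_ge0.
(* Hölder for the m-th column, set to zero from [n] on, because the contraction sees only its first
   [n] entries. *)
have slice m (d : R) : 0 <= d ->
    seq_bound r (fun j => if (j < n)%N then nrm (y (pair_nat (j, m))) else 0) d ->
    nrm (contract_seq phi n y m) <= b * d.
  move=> d0 hd.
  apply: le_trans (nrm_sum (fun j => phi j * y (pair_nat (j, m))) n) _.
  set g := (fun _ => _) in hd.
  have g0 j : 0 <= g j by rewrite /g; case: ifP => // _; exact: nrm_ge0.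
  rewrite (eq_big_nat _ _ (F2 := fun j => nrm (phi j) * g j)); last first.
    by move=> j /= jn; rewrite nrmM /g jn.
  apply: (@hoelder_counting R r _ g b d r1) => //; first by move=> ?; exact: nrm_ge0.
  exact/(Lnorm_seqP r1 g0 d0).
apply/lnormP => //; first exact: mulr_ge0.
move: yc => /(lnormP _ r1 c0); move: r1 slice; clear phib.
case: r => [r| |]//= r1 slice hy M; last first.
  by apply: slice => // j; case: ifP.
have r0 : 0 < r by move: r1; rewrite lee_fin; exact: lt_le_trans.
(* [D m] is the r-th power of the norm of the truncated column, so [slice] is applied with its r-th
   root. *)
pose D m := \sum_(0 <= j < n) nrm (y (pair_nat (j, m))) `^ r.
have D0 m : 0 <= D m by rewrite sumr_ge0// => j _; exact: powR_ge0.
apply: (@le_trans _ _ (\sum_(0 <= m < M) b `^ r * D m)).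
  apply: ler_sum => m _.
  have -> : D m = (D m `^ r^-1) `^ r.
    by rewrite -powRrM mulVf ?gt_eqF// powRr1.
  rewrite -powRM ?powR_ge0// ge0_ler_powR ?nnegrE ?nrm_ge0 ?mulr_ge0 ?powR_ge0 ?(ltW r0)//.
  apply: slice => [|N]; first exact: powR_ge0.
  rewrite -powRrM mulVf ?gt_eqF// powRr1//.
  rewrite (bigID (fun j => (j < n)%N))/= [X in _ + X]big1 ?addr0; last first.
    by move=> j /negbTE->; rewrite powR0// gt_eqF.
  under eq_bigr => j -> do [].
  rewrite -big_filter; apply: ler_sum_uniq_sub => [| | |j]; last exact: powR_ge0.
  - by rewrite filter_uniq ?iota_uniq.
  - exact: iota_uniq.
  - by move=> j; rewrite mem_filter !mem_index_iota => /andP[->].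
rewrite -mulr_sumr powRM// ler_wpM2l ?powR_ge0//.
rewrite exchange_big/=; have [N le_N] := @ler_sum_pair_nat R n M.
apply: le_trans (le_N (fun i => nrm (y i) `^ r) _) (hy N) => i; exact: powR_ge0.
Qed.

End sequences.

(** * Norming by truncated functionals of the conjugate exponent *)

Section duality.
Variables (R : realType) (k : scalars).
Local Notation K := (scalar_field R k).
Implicit Types (a phi : nat -> K) (r s : \bar R).

Lemma lnorm_delta s n : (1 <= s)%E ->
  (lnorm s (fun j => (j == n)%:R : K) <= 1%:E)%E.
Proof.
move=> s1; apply/lnormP => //.
have nrm_delta j : nrm ((j == n)%:R : K) = (j == n)%:R.
  case: (j == n); last exact: nrm0.
  by rewrite -[1%:R](@of_real1 R k) nrm_of_real normr1.
case: s s1 => [s| |]//= s1 m; last by rewrite nrm_delta lern1 leq_b1.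
have s0 : s != 0.
  by rewrite gt_eqF//; move: s1; rewrite lee_fin; exact: lt_le_trans.
rewrite (eq_bigr (fun i => if i == n then 1 else 0)); last first.
  by move=> i _; rewrite nrm_delta; case: (i == n); rewrite ?powR1 ?powR0.
rewrite -big_mkcond big_nat1_eq powR1; by case: ifP.
Qed.

Lemma sum_delta a n : \sum_(0 <= j < n.+1) (j == n)%:R * a j = a n.
Proof.
rewrite big_nat_recr//= eqxx mul1r big_nat big1 ?add0r// => j /andP[_ jn].
by rewrite lt_eqF// mul0r.
Qed.

(** For infinite [r] the coordinate functionals suffice. For finite [r], each partial sum is tested
    against a functional that attains equality in Hölder's inequality on the first [n]
    coordinates. *)
Lemma lnorm_le_dual r a (c : R) : (1 <= r)%E -> 0 <= c ->
  (forall phi n, (lnorm (hoelder_conjugate r) phi <= 1%:E)%E ->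
    nrm (\sum_(0 <= j < n) phi j * a j) <= c) ->
  (lnorm r a <= c%:E)%E.
Proof.
move=> r1 c0 ac; apply/lnormP => //.
have [roo|] := eqVneq r +oo%E.
  rewrite roo => n /=; rewrite -(sum_delta a n); apply: ac.
  by rewrite lnorm_delta// hoelder_conj_ge1.
case: r r1 ac => [r| |]//; rewrite lee_fin => r1 ac _ n /=.
have r0 : 0 < r by exact: lt_le_trans r1.
set N := \sum_(0 <= i < n) _.
have : 0 <= N by rewrite sumr_ge0// => i _; exact: powR_ge0.
rewrite le_eqVlt => /predU1P[<-|N0]; first exact: powR_ge0.
(* [t] is the norm of [a] cut off at [n]; the goal reduces to [t <= c]. *)
pose t := N `^ r^-1; have t0 : 0 < t by exact: powR_gt0.
have tV x : t^-1 `^ x = (t `^ x)^-1.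
  by rewrite -powR_inv1 ?(ltW t0)// powRAC powR_inv1 ?powR_ge0.
have tr : t `^ r = N by rewrite -powRrM mulVf ?gt_eqF// powRr1// ltW.
rewrite -tr ge0_ler_powR ?nnegrE ?(ltW t0) ?(ltW r0)//.
(* The extremal functional, written with [0 / 0 = 0] to avoid conjugation. *)
pose phi j : K :=
  if (j < n)%N then of_real (nrm (a j) `^ r / t `^ (r - 1)) / a j else 0.
(* Only an inequality: if [a j = 0] and [r = 1], the left side is 0 but the right side is 1. *)
have phi_le j : nrm (phi j) <= if (j < n)%N then (nrm (a j) / t) `^ (r - 1) else 0.
  rewrite /phi; case: ifP => _; last by rewrite nrm0.
  have [->|aj0] := eqVneq (a j) 0; first by rewrite invr0 mulr0 nrm0 powR_ge0.
  have naj0 : 0 < nrm (a j).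
    rewrite lt_neqAle nrm_ge0 andbT eq_sym; apply: contra aj0 => /eqP.
    by move/nrm_eq0 ->.
  have -> : nrm (of_real (nrm (a j) `^ r / t `^ (r - 1)) / a j) =
      nrm (a j) `^ r / t `^ (r - 1) / nrm (a j).
    rewrite nrmM nrm_of_real ger0_norm ?divr_ge0 ?powR_ge0//; congr (_ * _).
    by rewrite /nrm normfV -[`|a j|]to_realK// -of_realV !of_realK.
  rewrite -(mulr_powRB1 (ltW naj0) r0) -[_ / t]mulrC powRM ?invr_ge0 ?(ltW t0) ?(ltW naj0)//.
  by rewrite tV mulrC !mulrA mulVf ?gt_eqF// mul1r mulrC.
(* The pairing sums to N / t^(r-1), which is [t] because t^r = N. *)
have -> : t = nrm (\sum_(0 <= j < n) phi j * a j).
  rewrite (eq_big_nat _ _ (F2 := fun j => of_real (nrm (a j) `^ r / t `^ (r - 1)))).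
    have of_real_sum (u : nat -> R) m :
        \sum_(0 <= j < m) of_real (u j) = of_real (\sum_(0 <= j < m) u j) :> K.
      elim: m => [|m ih]; first by rewrite !big_geq// of_real0.
      by rewrite !big_nat_recr//= ih of_realD.
    rewrite of_real_sum -mulr_suml -/N -tr nrm_of_real.
    rewrite -(mulr_powRB1 (ltW t0) r0) mulfK ?gtr0_norm// gt_eqF//.
    exact: powR_gt0.
  move=> j /andP[_ jn]; rewrite /phi jn.
  have [->|aj0] := eqVneq (a j) 0; last by rewrite divfK.
  by rewrite nrm0 powR0 ?gt_eqF// mul0r of_real0 mulr0.
apply: ac; apply/lnormP => //; first by rewrite hoelder_conj_ge1// lee_fin.
move: r1; rewrite le_eqVlt => /predU1P[r1|r1].
  rewrite -r1 hoelder_conjugate1 => j /=.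
  by apply: le_trans (phi_le j) _; case: ifP; rewrite // -r1 subrr powRr0.
have -> : hoelder_conjugate r%:E = (r / (r - 1))%:E.
  by rewrite /hoelder_conjugate/= gt_eqF// inver subr_eq0 gt_eqF.
have rB0 : 0 < r - 1 by rewrite subr_gt0.
have q0 : 0 < r / (r - 1) by rewrite divr_gt0.
move=> m /=; rewrite powR1.
(* The conjugate exponent is r / (r - 1), so raising the bound [phi_le] to it gives |a_i|^r / N, and
   these terms sum to 1 over i < n. *)
apply: (@le_trans _ _ (\sum_(0 <= i < m | (i < n)%N) (nrm (a i) `^ r / N))).
  rewrite [leRHS]big_mkcond; apply: ler_sum => i _.
  have := phi_le i; case: ifP => _ h.
    have -> : nrm (a i) `^ r / N = (nrm (a i) / t) `^ (r - 1) `^ (r / (r - 1)).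
      rewrite -powRrM mulrCA divff ?gt_eqF// mulr1.
      rewrite powRM ?nrm_ge0 ?invr_ge0 ?(ltW t0)//.
      by rewrite tV tr.
    by rewrite ge0_ler_powR ?nnegrE ?nrm_ge0 ?powR_ge0 ?(ltW q0).
  have -> : nrm (phi i) = 0 by apply/eqP; rewrite eq_le h nrm_ge0.
  by rewrite powR0 ?gt_eqF.
have -> : 1 = \sum_(0 <= i < n) (nrm (a i) `^ r / N).
  by rewrite -mulr_suml divff// gt_eqF.
rewrite -big_filter; apply: ler_sum_uniq_sub => [| | |j].
- by rewrite filter_uniq ?iota_uniq.
- exact: iota_uniq.
- by move=> j; rewrite mem_filter !mem_index_iota => /andP[->].
- by rewrite divr_ge0 ?powR_ge0 ?(ltW N0).
Qed.

End duality.

(** * The left ideal property of the q-compact operators *)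

Section left_ideal.
Variables (R : realType) (k : scalars).
Local Notation K := (scalar_field R k).
Variables (E F G : normedModType K) (q : \bar R).
Variables (Q : F -> G) (b : R).
Hypotheses (q1 : (1 <= q)%E) (lQ : linear Q) (b0 : 0 <= b).
Hypothesis Qb : forall y, nrm (Q y) <= b * nrm y.

Let Q0 : Q 0 = 0.
Proof. by have := lQ (-1) 0 0; rewrite !scaler0 addr0 scaleN1r addNr. Qed.

Let QB x y : Q (x - y) = Q x - Q y.
Proof. by rewrite addrC -scaleN1r lQ scaleN1r addrC. Qed.

Lemma nrm_bounded_continuous : continuous Q.
Proof.
move=> x; apply/cvgrPdist_lt => e e0.
have b10 : 0 < b + 1 by rewrite ltr_wpDl.
have d0 : 0 < of_real (to_real e / (b + 1)) :> K.
  by rewrite -of_real0 ltr_of_real divr_gt0// to_real_gt0.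
near=> y; have : ball x (of_real (to_real e / (b + 1)) : K) y.
  by near: y; exact: nbhsx_ballx.
rewrite -ball_normE /= -QB !nrmE ltr_of_real => xy.
rewrite -[e]to_realK ?(ltW e0)// ltr_of_real.
apply: le_lt_trans (Qb _) _.
apply: (@le_lt_trans _ _ ((b + 1) * nrm (x - y))).
  by rewrite ler_wpM2r ?nrm_ge0// lerDl.
by rewrite mulrC -ltr_pdivlMr.
Unshelve. all: by end_near. Qed.

(** A continuous linear map passes through the convergent series, so the same coefficients serve. *)
Lemma pco_image x y : pco q x y -> pco q (Q \o x) (Q y).
Proof.
move=> [a a1 ay]; exists a => //.
rewrite (_ : series _ = Q \o series (fun n => a n *: x n)).
  by apply: cvg_comp ay _; exact: nrm_bounded_continuous.
apply/funext => n; rewrite /series/=.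
elim: n => [|n ih]; first by rewrite !big_geq.
by rewrite !big_nat_recr//= ih addrC -lQ addrC.
Qed.

Lemma lnorm_image x (c : R) :
  (lnorm q x <= c%:E)%E -> (lnorm q (Q \o x) <= (b * c)%:E)%E.
Proof.
move=> xc; have c0 : 0 <= c by rewrite -lee_fin (le_trans _ xc)// lnorm_ge0.
apply/lnormP => //; first exact: mulr_ge0.
move: xc => /(lnormP _ q1 c0); case: q q1 => [s| |]//= s1 h n.
  rewrite powRM//; apply: (le_trans _ (ler_wpM2l (powR_ge0 _ _) (h n))).
  rewrite mulr_sumr ler_sum// => i _; rewrite -powRM ?nrm_ge0//.
  rewrite ge0_ler_powR ?nnegrE ?mulr_ge0 ?nrm_ge0//.
  by move: s1; rewrite lee_fin; exact: le_trans.
by rewrite (le_trans (Qb _))// ler_wpM2l.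
Qed.

Lemma compact_operators_comp (T : E -> F) :
  compact_operators q E F T -> compact_operators q E G (Q \o T).
Proof.
move=> [lT cT qT]; split.
- by move=> c u v /=; rewrite lT lQ.
- by move=> x; apply: continuous_comp; [exact: cT|exact: nrm_bounded_continuous].
move: qT; case: ifPn => _.
  rewrite precompactE => cTB.
  have cs : compact (Q @` closure (T @` ball 0 1)).
    apply: continuous_compact => //; apply: continuous_subspaceT.
    exact: nrm_bounded_continuous.
  apply: (precompact_subset _ (compact_precompact (@norm_hausdorff _ _) cs)).
  by move=> _ [x x1 <-]; exists (T x) => //; apply: subset_closure; exists x.
move=> [x /lnorm_lt_oo[c c0 xc] Tx]; exists (Q \o x).
  by rewrite (le_lt_trans (lnorm_image (c := c) _)) ?xc ?ltry.
by move=> _ [u u1 <-]; apply: pco_image; apply: Tx; exists u.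
Qed.

Lemma compact_norm_comp (T : E -> F) : compact_operators q E F T ->
  compact_norm q (Q \o T) <= b * compact_norm q T.
Proof.
move=> cT; have n0 := compact_norm_ge0 q T.
apply/norm_boundP => //; first exact: compact_operators_comp.
  by rewrite mulr_ge0.
have := compact_norm_bound cT; rewrite /norm_bound; case: ifPn => _ Tc.
  by move=> x x1; apply: le_trans (Qb _) _; rewrite ler_wpM2l//; exact: Tc.
apply/lee_addgt0Pr => e e0.
have b10 : 0 < b + 1 by rewrite ltr_wpDl.
(* The infimum defining the measure need not be attained. After multiplication by [b] this slack is
   at most [e]; the added 1 covers [b = 0]. *)
have e'0 : 0 < e / (b + 1) by rewrite divr_gt0.
have [x xc Tx] := p_compact_measure_lt Tc (ltr_pwDr e'0 (lexx _)).
have := lnorm_image xc; rewrite mulrDr => Qxc; rewrite -EFinD.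
apply: (@le_trans _ _ (b * compact_norm q T + b * (e / (b + 1)))%:E).
  apply: p_compact_measure_le Qxc _ => _ [u u1 <-].
  by apply: pco_image; apply: Tx; exists u.
rewrite lee_fin lerD2l mulrCA ler_piMr ?(ltW e0)//.
by rewrite ler_pdivrMr// mul1r lerDl.
Qed.

End left_ideal.

(** * Tensors and contractions as operators on [ellbar] *)

Section tensor.
Variables (R : realType) (k : scalars) (r : exponent R).
Local Notation K := (scalar_field R k).
Local Notation F := (ellbar k r).
Implicit Types (a y : F).

Lemma ellbar_lnormE a : lnorm r (val a) = (nrm a)%:E.
Proof.
have [x _ xa] := lnorm_lt_oo (ellbar_lnorm (valP a)).
by rewrite /nrm [`|a|]/(ellbar_norm a) of_realK xa.
Qed.

(** For finite [r] the norm bound suffices. In c_0, a large code has a large coordinate, where one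
    factor is small while the other is bounded by its norm. *)
Lemma tensor_seq_ellbar a y : tensor_seq (val a) (val y) \in ellbar_mem r.
Proof.
have := valP a; have := valP y; rewrite !inE /=; case: ifPn => [_|_ _ _]; last first.
  apply: (@le_lt_trans _ _ (nrm a * nrm y)%:E); last exact: ltry.
  by apply: lnorm_tensor_seq; rewrite ?exponent_ge1 ?ellbar_lnormE.
move=> /cvg0_nrmP y0 /cvg0_nrmP a0; apply/cvg0_nrmP => e e0.
have pos z : 0 < nrm (z : F) + 1 by rewrite ltr_wpDl// nrm_ge0.
have coord z i : nrm (val z i) <= nrm (z : F).
  by apply: nrm_le_lnorm (exponent_ge1 r) _; rewrite ellbar_lnormE.
have [N aN] := a0 _ (divr_gt0 e0 (pos y)).
have [M yM] := y0 _ (divr_gt0 e0 (pos a)).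
have [L ltL] := pair_nat_bounded N M.
exists L => i Li; rewrite nrmM.
have [Ni|iN] := leqP N (unpair i).1.
  apply: (@le_lt_trans _ _ (nrm (val a (unpair i).1) * (nrm y + 1))).
    by rewrite ler_wpM2l ?nrm_ge0// (le_trans (coord _ _))// lerDl.
  by rewrite -ltr_pdivlMr ?pos//; exact: aN.
have [Mi|iM] := leqP M (unpair i).2.
  apply: (@le_lt_trans _ _ ((nrm a + 1) * nrm (val y (unpair i).2))).
    by rewrite ler_wpM2r ?nrm_ge0// (le_trans (coord _ _))// lerDl.
  by rewrite mulrC -ltr_pdivlMr ?pos//; exact: yM.
have := ltL _ _ iN iM.
by rewrite -surjective_pairing Cantor.cancel_to_of ltnNge Li.
Qed.

Definition tensor a y : F :=
  exist _ (tensor_seq (val a) (val y)) (tensor_seq_ellbar a y).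

Lemma tensor_linearl y : linear (tensor^~ y).
Proof.
move=> c a b; apply: val_inj; apply/funext => i.
have := mulrDl (c * val a (unpair i).1) (val b (unpair i).1) (val y (unpair i).2).
by rewrite -mulrA.
Qed.

Lemma tensor_linearr a : linear (tensor a).
Proof.
move=> c y z; apply: val_inj; apply/funext => i.
have := mulrDr (val a (unpair i).1) (c * val y (unpair i).2) (val z (unpair i).2).
by rewrite mulrCA.
Qed.

Lemma nrm_tensor_le a y : nrm (tensor a y) <= nrm a * nrm y.
Proof.
rewrite -lee_fin -ellbar_lnormE.
by apply: lnorm_tensor_seq; rewrite ?exponent_ge1 ?ellbar_lnormE.
Qed.

(** In c_0 the norm bound does not give membership; there the contraction is a finite combination of
    subsequences of a null sequence. *)
Lemma contraction_exists (phi : nat -> K) n (b : R) : 0 <= b ->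
  (lnorm (hoelder_conjugate r) phi <= b%:E)%E ->
  exists Q : F -> F, [/\ linear Q, forall y, nrm (Q y) <= b * nrm y &
    forall a y, Q (tensor a y) = (\sum_(0 <= j < n) phi j * val a j) *: y].
Proof.
move=> b0 phib.
have le_nrm y : (lnorm r (contract_seq phi n (val y)) <= (b * nrm y)%:E)%E.
  by apply: lnorm_contract_seq; rewrite ?exponent_ge1 ?ellbar_lnormE.
have mem y : contract_seq phi n (val y) \in ellbar_mem r.
  have := valP y; rewrite !inE /=; case: ifPn => _; last first.
    by move=> _; rewrite (le_lt_trans (le_nrm y)) ?ltry.
  move=> y0; rewrite /contract_seq; elim: {le_nrm} n => [|m ih].
    rewrite (_ : (fun _ => _) = cst 0); first exact: cvg_cst.
    by apply/funext => i; rewrite big_geq.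
  (* The code of (m, i) is at least i, so it tends to infinity with i. *)
  have ym : (fun i => val y (pair_nat (m, i))) @ \oo --> (0 : K).
    apply: cvg_comp y0 => P [N _ NP]; exists N => // i Ni.
    by apply: NP; exact: leq_trans (leq_pair_nat _ _).
  have := cvgD ih (cvgMl_tmp (a := phi m) ym); rewrite mulr0 addr0.
  move=> /(_ _ _); congr (_ @ \oo --> (0 : K)); apply/funext => i.
  by rewrite big_nat_recr.
exists (fun y => exist _ (contract_seq phi n (val y)) (mem y)); split.
- move=> c y z; apply: val_inj; apply/funext => i.
  pose s z := \sum_(0 <= j < n) phi j * val (z : F) (pair_nat (j, i)).
  change (s (c *: y + z) = c * s y + s z).
  rewrite /s mulr_sumr -big_split /=; apply: eq_bigr => j _.
  by rewrite mulrCA -mulrDr.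
- by move=> y; rewrite -lee_fin -[X in (X <= _)%E]ellbar_lnormE; exact: le_nrm.
- by move=> a y; apply: val_inj; exact: contract_tensor_seq.
Qed.

End tensor.

(** * Composing an operator with tensors by a fixed sequence *)

Section tensor_operators.
Variables (R : realType) (k : scalars) (r : exponent R).
Local Notation K := (scalar_field R k).
Local Notation F := (ellbar k r).
Variables (E : normedModType K) (q : exponent R).
Implicit Types (a : F) (S : E -> F).

Lemma compact_operatorsZ c S :
  compact_operators q E F S -> compact_operators q E F (c *: S).
Proof.
move=> cS; rewrite -[_ *: _]addr0; apply: compact_operatorsP => //.
  exact: exponent_ge1.
exact: compact_operators0 (exponent_ge1 q).
Qed.

Lemma compact_operators_tensor a S :
  compact_operators q E F S -> compact_operators q E F (tensor a \o S).
Proof.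
apply: (compact_operators_comp (exponent_ge1 q) (tensor_linearr a)
  (nrm_ge0 a)); exact: nrm_tensor_le.
Qed.

Lemma compact_norm_tensor a S : compact_operators q E F S ->
  compact_norm q (tensor a \o S) = nrm a * compact_norm q S.
Proof.
move=> cS; apply/eqP; rewrite eq_le; apply/andP; split.
  apply: (compact_norm_comp (exponent_ge1 q) (tensor_linearr a) (nrm_ge0 a)) => //.
  exact: nrm_tensor_le.
(* The lower bound is divided by the norm of [S] and becomes a bound on the norm of [a], to be
   proved by duality; norm zero is treated apart. *)
have [->|Sn0] := eqVneq (compact_norm q S) 0.
  by rewrite mulr0 compact_norm_ge0.
have S0 : 0 < compact_norm q S by rewrite lt_neqAle eq_sym Sn0 compact_norm_ge0.
rewrite -ler_pdivlMr// -lee_fin -ellbar_lnormE.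
apply: lnorm_le_dual => [||phi n phi1]; first exact: exponent_ge1.
  by rewrite divr_ge0 ?(ltW S0) ?compact_norm_ge0.
have [Q [lQ Q1 QE]] := contraction_exists n ler01 phi1.
rewrite ler_pdivlMr// -compact_normZ ?exponent_ge1//.
rewrite -[leRHS]mul1r.
have -> : (\sum_(0 <= j < n) phi j * val a j) *: S = Q \o (tensor a \o S).
  by apply/funext => x; rewrite /= QE.
apply: (compact_norm_comp (exponent_ge1 q) lQ ler01 Q1).
exact: compact_operators_tensor.
Qed.

(** Contracting with a coordinate functional at an index where [a] does not vanish returns a nonzero
    multiple of [S]. With exponent [p], this is what keeps the tensored operators outside K_p. *)
Lemma compact_operators_tensor_inv a S : a != 0 ->
  compact_operators q E F (tensor a \o S) -> compact_operators q E F S.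
Proof.
move=> a0 caS.
have [n an0] : exists n, val a n != 0.
  apply: contrapT => /forallNP an; move/eqP: a0; apply.
  by apply: val_inj; apply/funext => n; apply/eqP/negPn/negP; exact: an.
have [Q [lQ Q1 QE]] := contraction_exists n.+1 ler01
  (lnorm_delta k n (hoelder_conj_ge1 (exponent_ge1 r))).
have -> : S = (val a n)^-1 *: (Q \o (tensor a \o S)).
  apply/funext => x; rewrite scalrfctE /= QE sum_delta scalerA mulVf//.
  by rewrite scale1r.
apply: compact_operatorsZ.
exact: (compact_operators_comp (exponent_ge1 q) lQ ler01 Q1).
Qed.

End tensor_operators.

(** * Ranges of linear isometries and the Banach-Mazur distance *)

Section isometries.
Variables (R : realType) (k : scalars).
Local Notation K := (scalar_field R k).

Lemma opnorm_ge0 (V W : normedModType K) (f : V -> W) : 0 <= opnorm f.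
(* At exponent [+oo], [compact_norm] is by definition the operator norm. *)
Proof. by have := compact_norm_ge0 +oo%E f; rewrite /compact_norm eqxx. Qed.

Lemma opnorm_le1 (V W : normedModType K) (f : V -> W) :
  (forall x, nrm (f x) <= nrm x) -> opnorm f <= 1.
Proof.
move=> f1; apply: ge_sup; first by exists (nrm (f 0)), 0 => //; exact: ballxx.
move=> _ [x + <-]; rewrite -ball_normE /= sub0r normrN => x1.
rewrite (le_trans (f1 x))// -(@ler_of_real _ k) -nrmE of_real1; exact: ltW.
Qed.

(** [J] and its inverse on the range both have operator norm at most 1, so this pair alone witnesses
    the distance bound. *)
Lemma isometry_range_subspace (X Y : normedModType K) (J : Y -> X) :
  linear J -> (forall x, `|J x| = `|x|) ->
  exists M : linear_subspace X,
    [/\ [set` subspace_mem M] = range J, isomorphic M Y &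
        (banach_mazur M Y <= 1)%E].
Proof.
move=> lJ nJ.
have J0 : J 0 = 0 by have := lJ (-1) 0 0; rewrite !scaler0 addr0 scaleN1r addNr.
have JB x y : J (x - y) = J x - J y by rewrite addrC -scaleN1r lJ scaleN1r addrC.
have injJ : injective J.
  by move=> x y /eqP; rewrite -subr_eq0 -JB -normr_eq0 nJ normr_eq0 subr_eq0 => /eqP.
have sJ : submod_closed (mem (range J) : {pred X}).
  split; first by rewrite inE; exists 0.
  move=> c u v; rewrite !inE => -[x _ <-] [y _ <-].
  by exists (c *: x + y); rewrite ?lJ.
pose M := Subspace sJ.
have JT (m : M) : exists y, J y = val m.
  by have := valP m; rewrite inE => -[y _ ?]; exists y.
(* The inverse is chosen pointwise; injectivity of [J] then forces it to be linear. *)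
pose T (m : M) : Y := sval (cid (JT m)).
have TE m : J (T m) = val m by rewrite /T; case: cid.
have UM y : J y \in subspace_mem M by rewrite inE; exists y.
pose U y : M := exist _ (J y) (UM y).
have lT : linear T.
  by move=> c m m'; apply: injJ; rewrite lJ !TE.
have lU : linear U by move=> c y y'; apply: val_inj; exact: lJ.
have nT m : nrm (T m) <= 1 * nrm m.
  by rewrite mul1r /nrm -nJ TE.
have nU y : nrm (U y) <= 1 * nrm y.
  by rewrite mul1r /nrm [`|U y|]nJ.
have TU : isomorphism_pair T U.
  split => //.
  - exact: nrm_bounded_continuous lT ler01 nT.
  - exact: nrm_bounded_continuous lU ler01 nU.
  - by move=> m; apply: val_inj; exact: TE.
  - by move=> y; apply: injJ; rewrite TE.
exists M; split.
- by apply/seteqP; split=> x /=; rewrite inE.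
- by exists T, U.
apply: (@le_trans _ _ (opnorm T * opnorm U)%:E).
  by apply: ereal_inf_lbound; exists T, U.
rewrite lee_fin mulr_ile1 ?opnorm_ge0// opnorm_le1// => x.
  by rewrite -[leRHS]mul1r.
by rewrite -[leRHS]mul1r.
Qed.

End isometries.

(** * The isometric copy of [ellbar] and the distance bound *)

Section main.
Variables (R : realType) (k : scalars).
Local Notation K := (scalar_field R k).
Variables (E : normedModType K) (p q r : exponent R).
Local Notation F := (ellbar k r).
Local Notation X := (compact_op q E F).

Lemma tensor_isometry (S : X) : ~ compact_operators p E F (val S) ->
  exists J : F -> X, [/\ linear J, (forall a, `|J a| = `|a|) &
    forall a, a != 0 -> ~ compact_operators p E F (val (J a))].
Proof.
move=> pS; have cS : compact_operators q E F (val S).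
  by have := valP S; rewrite inE.
(* The zero operator is p-compact, so [S] is nonzero and the tensor map can be rescaled by the
   inverse of its norm to an isometry. *)
have S0 : compact_norm q (val S) != 0.
  apply: contra_notN pS => /eqP/(compact_norm_eq0 (exponent_ge1 q) cS) ->.
  exact: compact_operators0 (exponent_ge1 p).
pose c : K := of_real (compact_norm q (val S))^-1.
have c0 : c != 0.
  by rewrite /c of_realV invr_eq0 -of_real0 (can_eq (@of_realK R k)).
have memT a : c *: (tensor a \o val S) \in compact_op_mem q (E := E) (F := F).
  by rewrite inE; apply: compact_operatorsZ; exact: compact_operators_tensor.
pose J a : X := exist _ (c *: (tensor a \o val S)) (memT a).
exists J; split.
- move=> d a b; apply: val_inj; apply/funext => x.
  change (c *: tensor (d *: a + b) (val S x) =
    d *: (c *: tensor a (val S x)) + c *: tensor b (val S x)).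
  by rewrite tensor_linearl scalerDr !scalerA mulrC.
- move=> a; rewrite [LHS]/(compact_op_norm (J a)) /compact_op_norm /=.
  rewrite compact_normZ ?exponent_ge1//; last exact: compact_operators_tensor.
  rewrite compact_norm_tensor// nrm_of_real ger0_norm ?invr_ge0 ?compact_norm_ge0//.
  by rewrite mulrCA mulVf// mulr1 -nrmE.
- move=> a a0 cJ; apply: pS; apply: (@compact_operators_tensor_inv _ _ _ _ _ a) => //.
  have := compact_operatorsZ c^-1 cJ.
  by rewrite /J /= scalerA mulVf// scale1r.
Qed.

(** The q-compact norm dominates the operator norm. Hence the infimum in the distance estimate is at
    least 1, and a copy at distance at most 1 is enough. *)
Lemma norm_ratio_ge1 (S : X) : S != 0 -> 1 <= nrm S / opnorm (val S).
Proof.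
move=> S0; have cS : compact_operators q E F (val S).
  by have := valP S; rewrite inE.
have [lS ctS _] := cS.
have [C SC] := linear_ball_bounded lS ctS.
have nS : nrm S = compact_norm q (val S).
  by rewrite /nrm [`|S|]/(compact_op_norm S) of_realK.
have le_op : opnorm (val S) <= nrm S.
  rewrite nS; apply: ge_sup; first by exists (nrm (val S 0)), 0 => //; exact: ballxx.
  move=> _ [x x1 <-]; apply: (norm_bound_nrm (exponent_ge1 q)) x1.
  exact: compact_norm_bound.
(* Positivity excludes the convention x / 0 = 0. The bound [C] ensures that the supremum is a
   genuine one, so that its vanishing forces [S = 0]. *)
have op0 : 0 < opnorm (val S).
  rewrite lt_neqAle opnorm_ge0 andbT eq_sym; apply: contra S0 => /eqP op0.
  apply/eqP/val_inj.
  apply: (@norm_bound0_eq0 _ _ +oo%E) => //; first exact: leey.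
  rewrite /norm_bound eqxx => x x1; rewrite -op0; apply: ub_le_sup; last by exists x.
  by exists C => _ [y y1 <-]; exact: SC.
by rewrite ler_pdivlMr// mul1r.
Qed.

End main.

Theorem theorem2p3 (R : realType) (k : scalars)
    (E : completeNormedModType (scalar_field R k)) (p q r : exponent R)
    (pq : ((p : \bar R) < (q : \bar R))%E) :
  let F : normedModType (scalar_field R k) := ellbar k r in
  let X : normedModType (scalar_field R k) := compact_op q E F in
  let A : set X :=
    [set S | (compact_operators q E F `\` compact_operators p E F) (\val S)] in
  [/\ A = set0 \/ spaceable F A,
      A !=set0 ->
        exists M : linear_subspace X,
          [/\ [set` subspace_mem M] `<=` A `|` [set 0],
              isomorphic M F &
              (banach_mazur M F <=
                 ereal_inf [set ((nrm S / opnorm (\val S))%R)%:E | S in A])%E] &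
      A !=set0 -> ((q : \bar R) <= (r : \bar R))%E ->
        isometrically_spaceable F A].
Proof.
move=> F X A.
have isoA : A !=set0 -> exists J : F -> X, [/\ linear J,
    (forall x, `|J x| = `|x|) & range J `<=` A `|` [set 0]].
  move=> [S [_ /tensor_isometry[J [lJ nJ JA]]]]; exists J; split=> //.
  (* Only [a = 0] is sent to the origin; every other image stays outside K_p. *)
  move=> _ [a _ <-]; have [->|a0] := eqVneq a 0.
    by right; apply/eqP; rewrite -normr_eq0 nJ normr0.
  by left; split; [have := valP (J a); rewrite inE|exact: JA].
have subA : A !=set0 -> exists M : linear_subspace X,
    [/\ [set` subspace_mem M] `<=` A `|` [set 0], isomorphic M F &
        (banach_mazur M F <=
           ereal_inf [set ((nrm S / opnorm (\val S))%R)%:E | S in A])%E].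
  move=> /isoA[J [lJ nJ JA]].
  have [M [MJ isoM bmM]] := isometry_range_subspace lJ nJ.
  exists M; split; rewrite ?MJ//.
  apply: (le_trans bmM); apply: le_ereal_inf_tmp => _ [S [_ pS] <-].
  rewrite lee_fin; apply: norm_ratio_ge1; apply: contra_notN pS => /eqP ->.
  exact: compact_operators0 (exponent_ge1 p).
split=> // [|/isoA[J ?] _]; last by exists J.
have [->|/set0P/subA[M [MA isoM _]]] := eqVneq A set0; first by left.
by right; exists M.
Qed.
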